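(* Let $k$ be a positive integer. Every directed graph $G$ can be edge-decomposed into $k$ factors $G_1,\ldots,G_k$ such that for each $i$ with $1\le i\le k$ and each vertex $v$, $$|d^+_{G_i}(v)-d^+_G(v)/k|<1 \quad\text{and}\quad |d^-_{G_i}(v)-d^-_G(v)/k|<1.$$ In particular, $|d_{G_i}(v)-d_G(v)/k|<1$ whenever $d^+_G(v)$ or $d^-_G(v)$ is divisible by $k$. Furthermore, such a decomposition can be chosen so that it additionally satisfies condition (i) below, and such a decomposition can also be chosen so that it additionally satisfies condition (ii) below: (i) $\big|\,|E(G_i)|-|E(G)|/k\,\big|<1$ for every $1\le i\le k$; (ii) for every vertex $u$ with $d^+_G(u)\equiv d^-_G(u) \pmod k$, we have $d_{G_i}(u)\equiv (d^+_G(u)-d^-_G(u))/k \pmod 2$ for every $1\le i\le k$.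
   Context: Graphs are finite and may have loops and multiple edges. A factor of $G$ is a spanning subgraph; ''edge-decomposed into factors $G_1,\ldots,G_k$'' means the edge set of $G$ is partitioned into the edge sets of the spanning subgraphs $G_1,\ldots,G_k$, each carrying the induced orientation. $d^+_G(v)$ and $d^-_G(v)$ denote out-degree and in-degree, and $d_G(v)=d^+_G(v)+d^-_G(v)$ is the degree (a loop at $v$ contributes $1$ to each of $d^+_G(v)$, $d^-_G(v)$). *)

(* Defs.v *)
From HB Require Import structures.
From mathcomp Require Import all_boot all_order all_algebra.
Set Implicit Arguments.
Unset Strict Implicit.
Unset Printing Implicit Defensive.
Import Order.TTheory GRing.Theory Num.Theory.

(** Finite directed multigraphs: loops are edges [e] with [src e = tgt e], and
    distinct edges may share both their source and their target. *)
Record digraph := Digraph {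
  vertex : finType;
  edge : finType;
  src : edge -> vertex;
  tgt : edge -> vertex
}.

Definition outdeg (G : digraph) (v : vertex G) : nat :=
  #|[set e : edge G | src e == v]|.

Definition indeg (G : digraph) (v : vertex G) : nat :=
  #|[set e : edge G | tgt e == v]|.

Definition deg (G : digraph) (v : vertex G) : nat := outdeg v + indeg v.

(** The spanning subgraph of [G] with edge set [F]: its vertex type is that of
    [G], so a vertex of [G] can be used as a vertex of [factor F]. *)
Definition factor (G : digraph) (F : {set edge G}) : digraph :=
  @Digraph (vertex G) {e : edge G | e \in F}
    (fun e => src (val e)) (fun e => tgt (val e)).

(** The parts may be empty, so [partition] of [finset] would be too strong. *)
Definition edge_decomposition (G : digraph) (k : nat)
    (D : 'I_k -> {set edge G}) : Prop :=
  \bigcup_(i < k) D i = [set: edge G] /\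
  (forall i j : 'I_k, i != j -> [disjoint D i & D j]).

Local Open Scope ring_scope.

(** [share_close k a b] is |a - b/k| < 1, over the rationals. *)
Definition share_close (k a b : nat) : Prop :=
  `| a%:R - b%:R / k%:R | < 1 :> rat.

Definition balanced_decomposition (G : digraph) (k : nat)
    (D : 'I_k -> {set edge G}) : Prop :=
  edge_decomposition D /\
  (forall (i : 'I_k) (v : vertex G),
     share_close k (@outdeg (factor (D i)) v) (outdeg v) /\
     share_close k (@indeg (factor (D i)) v) (indeg v)).

Definition size_balanced (G : digraph) (k : nat)
    (D : 'I_k -> {set edge G}) : Prop :=
  forall i : 'I_k, share_close k #|edge (factor (D i))| #|edge G|.

(** The quotient is taken in [int] because [outdeg u - indeg u] may be negative;
    it is exact under the congruence hypothesis. *)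
Definition parity_condition (G : digraph) (k : nat)
    (D : 'I_k -> {set edge G}) : Prop :=
  forall u : vertex G, (outdeg u = indeg u %[mod k])%N ->
  forall i : 'I_k,
    ((@deg (factor (D i)) u)%:Z
       = (((outdeg u)%:Z - (indeg u)%:Z) %/ k%:Z)%Z %[mod 2])%Z.

(* Main.v *)
Require Import Defs.
From HB Require Import structures.
From mathcomp Require Import all_boot all_order all_algebra.
From mathcomp Require Import zify.
Set Implicit Arguments.
Unset Strict Implicit.
Unset Printing Implicit Defensive.

Import Order.TTheory GRing.Theory Num.Theory.

(** Colour the edges with [k] colours so as to minimise the sum of the squares
    of the numbers of edges of each colour in each class, a class being the set
    of out-edges of a vertex, the set of in-edges of a vertex, and so on.  Any
    two colours [i], [j] can be made nearly equal in all classes at once: pair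
    up the edges coloured [i] or [j] inside each out-class (leaving at most one
    unpaired) and likewise inside each in-class; the union of the two pairings
    is bipartite, and a proper 2-colouring of it redistributes [i] and [j].
    Hence the minimiser is nearly equal in every class.

    The out-pairing can in addition be extended to a pairing for a coarser
    partition.  With the one-class partition this gives (i).  For (ii), add
    loops at each vertex with congruent semidegrees to make these divisible by
    [k], and let the set of added loops at a vertex be a class of its own: each
    colour then has at most one of them, and removing it lowers both
    semidegrees. *)

(** * Two-colourings that alternate along two involutions *)

Section Involutions.

Variables (T : finType) (s t : T -> T).
Hypotheses (sK : involutive s) (tK : involutive t).

(** Conjugation by [s] inverts [p], so [s] permutes the cycles of [p]. It never maps a cycle to
    itself, and [t x] lies in the cycle of [s x]; hence colouring the two cycles of each swapped
    pair differently works for both. *)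
Lemma fixfree_involutions_2col :
  (forall x, s x != x) -> (forall x, t x != x) ->
  exists chi : T -> bool,
    (forall x, chi (s x) = ~~ chi x) /\ (forall x, chi (t x) = ~~ chi x).
Proof.
move=> sN tN; pose p x := s (t x).
have pI : injective p by move=> x y /(inv_inj sK)/(inv_inj tK).
have ps x : p (s (p x)) = s x by rewrite /p sK tK.
(* Two-step induction: by [ps], p^(n+2) x = s x gives p^n (p x) = s (p x). The cases n = 0 and n = 1
   would yield a fixed point of [s] or of [t]. *)
have itN n x : (iter n p x != s x) && (iter n.+1 p x != s x).
  elim: n x => [|n IH] x.
    rewrite /= eq_sym sN /=; apply/eqP => /(inv_inj sK) tx.
    by case/eqP: (tN x).
  have /andP[_ ->] := IH x.
  have /andP[+ _] := IH (p x); rewrite -iterSr /= => pn.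
  by rewrite -[s x]ps (inj_eq pI).
have psym := fconnect_sym pI.
have rN x : froot p x != froot p (s x).
  apply/negP => /eqP/(fingraph.rootP psym) /iter_findex => e.
  by have /andP[/eqP] := itN (findex p x (s x)) x.
have rp x : froot p (p x) = froot p x.
  by apply/esym/(fingraph.rootP psym)/fconnect1.
have rt x : froot p (t x) = froot p (s x).
  by rewrite -rp /p tK.
have rst x : froot p (s (t x)) = froot p x by apply: rp.
have ltN x : enum_rank (froot p (s x)) < enum_rank (froot p x)
    = ~~ (enum_rank (froot p x) < enum_rank (froot p (s x))).
  rewrite -leqNgt ltn_neqAle (inj_eq val_inj) (inj_eq enum_rank_inj).
  by rewrite eq_sym rN.
(* The ranks of the cycle roots decide which of two swapped cycles is coloured [true]. *)
exists (fun x => enum_rank (froot p x) < enum_rank (froot p (s x))); split=> x.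
  by rewrite sK ltN.
by rewrite rt rst ltN.
Qed.

End Involutions.

Lemma involutions_2col (T : finType) (s t : T -> T) :
  involutive s -> involutive t ->
  exists chi : T -> bool,
    (forall x, s x != x -> chi (s x) = ~~ chi x) /\
    (forall x, t x != x -> chi (t x) = ~~ chi x).
Proof.
(* Fixed points are removed by taking two copies of [T]: a fixed point is paired with its own copy,
   and any other point keeps its partner within each copy. *)
pose dbl (f : T -> T) (u : T * bool) :=
  if f u.1 == u.1 then (u.1, ~~ u.2) else (f u.1, u.2).
have dblK f : involutive f -> involutive (dbl f).
  move=> fK [x b]; rewrite /dbl /=; have [fx|fx] := eqVneq (f x) x.
    by rewrite /= fx eqxx negbK.
  by rewrite /= fK eq_sym (negPf fx).
have dblN f u : dbl f u != u.
  case: u => x b; rewrite /dbl /=; have [_|fx] := eqVneq (f x) x.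
    by rewrite xpair_eqE eqxx; case: b.
  by rewrite xpair_eqE (negPf fx).
move=> sK tK.
have [chi [chis chit]] :=
  fixfree_involutions_2col (dblK s sK) (dblK t tK) (dblN s) (dblN t).
exists (fun x => chi (x, false)); split=> x fx.
  by rewrite -chis /dbl /= (negPf fx).
by rewrite -chit /dbl /= (negPf fx).
Qed.

(** * Pairings inside classes and equitable 2-colourings *)

(** Two unpaired points of one class can be paired with each other without touching existing pairs;
    this lowers the number of fixed points. *)
Lemma extend_pairing (E : finType) (T : eqType) (h : E -> T) (s : E -> E) :
  involutive s -> (forall x, h (s x) = h x) ->
  exists s' : E -> E,
    [/\ involutive s', forall x, h (s' x) = h x,
        forall x, s x != x -> s' x = s x
      & forall x y, s' x = x -> s' y = y -> h x = h y -> x = y].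
Proof.
have [n] := ubnP #|[set x | s x == x]|; elim: n s => // n IH s lt_n sK hs.
have [/existsP[x /existsP[y]]|] := boolP [exists x, exists y,
    [&& s x == x, s y == y, h x == h y & x != y]].
  move=> /and4P[/eqP sx /eqP sy /eqP hxy xy].
  pose s1 z := if z == x then y else if z == y then x else s z.
  have s1K : involutive s1.
    move=> z; rewrite /s1; have [->|zx] := eqVneq z x.
      by rewrite eq_sym (negPf xy) eqxx.
    have [->|zy] := eqVneq z y; first by rewrite eqxx.
    by rewrite (inv_eq sK) sx (negPf zx) (inv_eq sK) sy (negPf zy) sK.
  have hs1 z : h (s1 z) = h z.
    rewrite /s1; have [->|_] := eqVneq z x; first by [].
    by have [->|_] := eqVneq z y.
  have [|s' [s'K hs' s's s'f]] := IH s1 _ s1K hs1.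
    rewrite ltnS in lt_n; apply: leq_trans lt_n.
    apply/proper_card/properP; split.
      apply/subsetP => z; rewrite !inE /s1.
      have [->|zx] := eqVneq z x; first by rewrite sx eqxx.
      by have [->|zy] := eqVneq z y; first by rewrite sy eqxx.
    by exists x; rewrite !inE ?sx // /s1 eqxx eq_sym.
  exists s'; split=> // z sz.
  have zx : z != x by apply: contraNneq sz => ->; rewrite sx.
  have zy : z != y by apply: contraNneq sz => ->; rewrite sy.
  have s1z : s1 z = s z by rewrite /s1 (negPf zx) (negPf zy).
  by rewrite s's s1z.
move=> noxy; exists s; split=> // x y sx sy hxy; apply/eqP.
apply: contraNT noxy => xy; apply/existsP; exists x; apply/existsP; exists y.
by rewrite sx sy hxy !eqxx.
Qed.

Definition class_size (E : finType) (C : eqType) (c : E -> C) (K : pred E)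
  (i : C) : nat := #|[set x | K x & c x == i]|.

Definition equitable (E : finType) (C : eqType) (c : E -> C) (K : pred E) :=
  forall i j : C, class_size c K i <= class_size c K j + 1.

Lemma equitable_pairing (E : finType) (s : E -> E) (chi : E -> bool)
    (K : pred E) :
  involutive s -> (forall x, s x != x -> chi (s x) = ~~ chi x) ->
  (forall x y, K x -> K y -> (s x == x) || ~~ K (s x) ->
     (s y == y) || ~~ K (s y) -> x = y) ->
  equitable chi K.
Proof.
move=> sK chis Kb i j.
have [->|ij] := eqVneq i j; first by rewrite leq_addr.
(* Points of colour [i] with a partner in [K] inject by [s] into those of colour [j]; at most one
   point of [K] has no partner there. *)
rewrite /class_size -(cardsID [set x | (s x == x) || ~~ K (s x)]) addnC.
rewrite leq_add //.
  rewrite -(card_imset _ (inv_inj sK)); apply/subset_leq_card/subsetP => y.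
  case/imsetP => x; rewrite !inE negb_or negbK => /andP[/andP[sx Ks]].
  move=> /andP[Kx /eqP ci] ->; rewrite Ks chis // ci.
  by case: (i) (j) ij => [] [].
apply/card_le1_eqP => x y; rewrite !inE => /andP[/andP[Kx _] bx].
by move=> /andP[/andP[Ky _] By]; apply: Kb.
Qed.

(** Two partitions can share one involution because [a1] refines [a2]: the pairing of the
    [a1]-classes extends to the [a2]-classes. The second involution is left for [b]. *)
Lemma equitable_2split (E : finType) (A1 A2 B : eqType)
    (a1 : E -> A1) (a2 : E -> A2) (b : E -> B) :
  (forall x y, a1 x = a1 y -> a2 x = a2 y) ->
  exists chi : E -> bool,
    [/\ forall v, equitable chi [pred x | a1 x == v],
        forall v, equitable chi [pred x | a2 x == v]
      & forall v, equitable chi [pred x | b x == v]].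
Proof.
move=> a12.
have [s1 [s1K a1s _ s1f]] := extend_pairing (h := a1) (s := id)
  (fun=> erefl) (fun=> erefl).
have [s [sK a2s ss1 sf]] := extend_pairing s1K (fun x => a12 _ _ (a1s x)).
have [t [tK bt _ tf]] := extend_pairing (h := b) (s := id)
  (fun=> erefl) (fun=> erefl).
have [chi [chis chit]] := involutions_2col sK tK.
(* Pairs added in the extension may cross [a1]-classes, but only between points that [s1] left
   unpaired. *)
have s1fix x v : a1 x = v -> (s x == x) || (a1 (s x) != v) -> s1 x = x.
  move=> <- /orP H; apply/eqP; apply: contraT => s1x.
  by case: H; rewrite (ss1 _ s1x) ?a1s ?eqxx // (negPf s1x).
exists chi; split=> v.
- apply: (equitable_pairing sK chis) => x y /= /eqP xv /eqP yv Bx By.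
  by apply: s1f; rewrite ?(s1fix _ v) // xv yv.
- apply: (equitable_pairing sK chis) => x y /= /eqP xv /eqP yv.
  rewrite !a2s xv yv eqxx !orbF => /eqP sx /eqP sy.
  by apply: sf; rewrite // xv yv.
- apply: (equitable_pairing tK chit) => x y /= /eqP xv /eqP yv.
  rewrite !bt xv yv eqxx !orbF => /eqP sx /eqP sy.
  by apply: tf; rewrite // xv yv.
Qed.

(** * From two colours to [k] colours *)

Lemma recolour_pair (E X : finType) (C : eqType) (K : X -> pred E)
    (c : E -> C) (i j : C) :
  i != j ->
  (exists chi : {z : E | c z \in pred2 i j} -> bool,
     forall x, equitable chi [pred y | K x (val y)]) ->
  exists c' : E -> C, forall x,
    [/\ class_size c' (K x) i <= class_size c' (K x) j + 1,
        class_size c' (K x) j <= class_size c' (K x) i + 1,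
        class_size c' (K x) i + class_size c' (K x) j
          = class_size c (K x) i + class_size c (K x) j
      & forall l, l != i -> l != j ->
          class_size c' (K x) l = class_size c (K x) l].
Proof.
move=> ij [chi chiP].
pose c' z := if insub z is Some y then (if chi y then i else j) else c z.
have c'E (y : {z : E | c z \in pred2 i j}) :
    c' (val y) = if chi y then i else j.
  by rewrite /c' valK.
have c'N z : c z \notin pred2 i j -> c' z = c z.
  by rewrite /c' => nz; rewrite insubN.
have liftP z : c z \in pred2 i j ->
    exists y : {z : E | c z \in pred2 i j}, z = val y.
  by move=> zP; exists (Sub z zP); rewrite SubK.
have size_c' x d : class_size c' (K x) (if d then i else j)
    = #|[set y | K x (val y) & chi y == d]|.
  rewrite /class_size -(card_imset _ val_inj); apply: eq_card => z.
  rewrite inE; apply/andP/imsetP => [[Kz /eqP cz]|[y]]; last first.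
    rewrite inE => /andP[Ky /eqP yd] ->; split=> //.
    by rewrite c'E yd.
  have [zP|nz] := boolP (c z \in pred2 i j); last first.
    by move: (nz); rewrite -(c'N _ nz) cz !inE; case: (d); rewrite eqxx ?orbT.
  have [y zy] := liftP z zP; exists y; rewrite // inE -zy Kz /=.
  move: cz; rewrite zy c'E.
  by case: (chi _); case: (d) => // e; rewrite e eqxx in ij.
have sum_c (c1 : E -> C) x :
    class_size c1 (K x) i + class_size c1 (K x) j
      = #|[set z | K x z & c1 z \in pred2 i j]|.
  have dis : [set z | K x z & c1 z == i] :&: [set z | K x z & c1 z == j] = set0.
    apply/setP => z; rewrite !inE; apply/negP => /andP[/andP[_ /eqP->]].
    by rewrite (negPf ij) andbF.
  rewrite /class_size -cardsUI dis cards0 addn0.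
  by apply: eq_card => z; rewrite !inE -andb_orr.
have c'_in z : (c' z \in pred2 i j) = (c z \in pred2 i j).
  have [zP|nz] := boolP (c z \in pred2 i j); last by rewrite c'N ?(negPf nz).
  have [y ->] := liftP z zP; rewrite c'E !inE.
  by case: (chi _); rewrite eqxx ?orbT.
exists c' => x; split.
- by rewrite (size_c' x true) (size_c' x false); apply: chiP.
- by rewrite (size_c' x true) (size_c' x false); apply: chiP.
- by rewrite !sum_c; apply: eq_card => z; rewrite !in_set c'_in.
- move=> l li lj; apply: eq_card => z; rewrite !in_set; congr (_ && _).
  have [zP|/c'N->//] := boolP (c z \in pred2 i j).
  have H u : u \in pred2 i j -> (u == l) = false.
    case/pred2P=> ->; rewrite eq_sym; first exact: negPf li.
    exact: negPf lj.
  by rewrite !H // c'_in.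
Qed.

Lemma sum_sqr_near_le (a b a' b' : nat) :
  a' <= b' + 1 -> b' <= a' + 1 -> a' + b' = a + b ->
  a' ^ 2 + b' ^ 2 <= a ^ 2 + b ^ 2.
Proof. by move=> h1 h2 h3; case: (ltngtP a a') => ?; nia. Qed.

Lemma sum_sqr_near_lt (a b a' b' : nat) :
  a' <= b' + 1 -> b' <= a' + 1 -> a' + b' = a + b -> b + 1 < a ->
  a' ^ 2 + b' ^ 2 < a ^ 2 + b ^ 2.
Proof.
move=> h1 h2 h3 h4; have lt_a : a' < a by lia.
(* Moving e = [d.+1] units lowers the sum of squares by 2e(a' - b), which is positive. *)
have [d ad] : exists d, a = a' + d.+1 by exists (a - a').-1; lia.
have bd : b' = b + d.+1 by lia.
by rewrite ad bd -!mulnn; nia.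
Qed.

(** The splitting is assumed for every [P] because it is applied to the elements of two colours of
    the minimiser, which is not known in advance. *)
Lemma equitable_colouring (E X : finType) (k : nat) (K : X -> pred E) :
  0 < k ->
  (forall P : pred E, exists chi : {z : E | P z} -> bool,
     forall x, equitable chi [pred y | K x (val y)]) ->
  exists c : E -> 'I_k, forall x, equitable c (K x).
Proof.
case: k => // k _ split2.
pose sq (c : E -> 'I_k.+1) x := \sum_i class_size c (K x) i ^ 2.
case: (arg_minnP (fun c : {ffun E -> 'I_k.+1} => \sum_x sq c x)
         (erefl : predT [ffun=> ord0])) => c _ cmin.
exists c => x0 i j; rewrite leqNgt; apply/negP => big_ij.
have ij : i != j by apply: contraTneq big_ij => ->; rewrite -leqNgt leq_addr.
have [c' c'P] := recolour_pair ij (split2 (fun z => c z \in pred2 i j)).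
pose c1 := [ffun z => c' z].
have c1E x l : class_size c1 (K x) l = class_size c' (K x) l.
  by apply: eq_card => z; rewrite !inE ffunE.
have := cmin c1 isT; apply/negP; rewrite -ltnNge.
have sqE (c2 : E -> 'I_k.+1) x : sq c2 x =
    class_size c2 (K x) i ^ 2 + class_size c2 (K x) j ^ 2
    + \sum_(l | (l != i) && (l != j)) class_size c2 (K x) l ^ 2.
  by rewrite /sq (bigD1 i) //= (bigD1 j) 1?eq_sym //= addnA.
have rest x : \sum_(l | (l != i) && (l != j)) class_size c1 (K x) l ^ 2
    = \sum_(l | (l != i) && (l != j)) class_size c (K x) l ^ 2.
  by apply: eq_bigr => l /andP[li lj]; rewrite c1E; case: (c'P x) => _ _ _ ->.
have sq_le x : sq c1 x <= sq c x.
  rewrite !sqE rest leq_add2r !c1E.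
  by case: (c'P x) => h1 h2 h3 _; apply: sum_sqr_near_le.
(* The term of [x0] drops strictly and no other term grows. *)
rewrite (bigD1 x0) //= [ltnRHS](bigD1 x0) //= -addSn leq_add ?leq_sum //.
rewrite !sqE rest -addSn leq_add2r !c1E.
by case: (c'P x0) => h1 h2 h3 _; apply: sum_sqr_near_lt.
Qed.

Lemma equitable_colouring3 (E : finType) (A1 A2 B : finType) (k : nat)
    (a1 : E -> A1) (a2 : E -> A2) (b : E -> B) :
  0 < k ->
  (forall x y, a1 x = a1 y -> a2 x = a2 y) ->
  exists c : E -> 'I_k,
    [/\ forall v, equitable c [pred x | a1 x == v],
        forall v, equitable c [pred x | a2 x == v]
      & forall v, equitable c [pred x | b x == v]].
Proof.
move=> k0 a12; pose K (v : A1 + A2 + B) : pred E :=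
  match v with
  | inl (inl v) => [pred x | a1 x == v]
  | inl (inr v) => [pred x | a2 x == v]
  | inr v => [pred x | b x == v]
  end.
have [P|c cP] := equitable_colouring (K := K) k0.
  have [chi [c1 c2 c3]] := equitable_2split (b \o val)
    (fun x y : {z | P z} => a12 (val x) (val y)).
  by exists chi => -[[v|v]|v]; [apply: c1|apply: c2|apply: c3].
exists c; split=> v; [exact: cP (inl (inl v))|exact: cP (inl (inr v))|].
exact: cP (inr v).
Qed.

(** * Equitable colourings give fair shares *)

Lemma share_closeP (k a b : nat) : 0 < k ->
  share_close k a b <-> (k * a < b + k) /\ (b < k * a + k).
Proof.
move=> k0; have k0' : (0 < k%:R :> rat)%R by rewrite ltr0n.
have kab : (k%:R * (a%:R - b%:R / k%:R) = k%:R * a%:R - b%:R :> rat)%R.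
  by rewrite mulrBr mulrC [X in (_ - X)%R]mulrC divfK ?lt0r_neq0.
rewrite /share_close -(ltr_pM2l k0') mulr1 -{1}[k%:R%R]ger0_norm ?ltW //.
rewrite -normrM kab ltr_norml ltrBrDr ltrBlDr addrC ltrBlDr.
rewrite -natrM -!natrD !ltr_nat [k + b]addnC.
by split=> [/andP[]|[-> ->]].
Qed.

Lemma equitable_share_close (E : finType) (k : nat) (c : E -> 'I_k)
    (K : pred E) (i : 'I_k) :
  equitable c K -> share_close k (class_size c K i) #|[set x | K x]|.
Proof.
move=> cK; have k0 : 0 < k by apply: leq_ltn_trans (ltn_ord i).
have sumE : #|[set x | K x]| = \sum_j class_size c K j.
  rewrite -sum1_card (partition_big c predT) //=; apply: eq_bigr => j _.
  rewrite /class_size -sum1_card; apply: eq_bigl => x.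
  by rewrite !inE.
have const n : \sum_(j < k) n = k * n by rewrite sum_nat_const card_ord.
(* Summing the [k] inequalities gives an error of at most [k]; the term [j = i], where colour [i] is
   compared with itself, makes it strict. *)
have ltS (f g : 'I_k -> nat) :
    (forall j, f j <= g j + 1) -> f i <= g i -> \sum_j f j < \sum_j g j + k.
  move=> fg fgi; rewrite -[X in _ + X]muln1 -const -big_split /=.
  rewrite (bigD1 i) //= [ltnRHS](bigD1 i) //= -addSn leq_add ?leq_sum //.
  by rewrite addn1.
by apply/share_closeP => //; rewrite sumE -!const; split; apply: ltS => // j;
  apply: cK.
Qed.

(** * Colour classes as factors, and condition (i) *)

Section Factors.

Variable G : digraph.

Lemma factor_outdeg (F : {set edge G}) (v : vertex G) :
  @outdeg (factor F) v = #|[set e in F | src e == v]|.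
Proof.
rewrite /outdeg -(card_imset _ val_inj); apply: eq_card => e.
rewrite inE; apply/imsetP/andP => [[f]|[eF ev]].
  by rewrite inE => fv ->; split; [apply: (valP f)|].
by exists (Sub e eF); rewrite // inE.
Qed.

Lemma factor_indeg (F : {set edge G}) (v : vertex G) :
  @indeg (factor F) v = #|[set e in F | tgt e == v]|.
Proof.
rewrite /indeg -(card_imset _ val_inj); apply: eq_card => e.
rewrite inE; apply/imsetP/andP => [[f]|[eF ev]].
  by rewrite inE => fv ->; split; [apply: (valP f)|].
by exists (Sub e eF); rewrite // inE.
Qed.

Lemma card_factor_edge (F : {set edge G}) : #|edge (factor F)| = #|F|.
Proof. by rewrite /= card_sig; apply: eq_card. Qed.

Variables (k : nat) (k0 : 0 < k).

Definition colour_classes (c : edge G -> 'I_k) (i : 'I_k) : {set edge G} :=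
  [set e | c e == i].

Lemma colour_classes_decomposition (c : edge G -> 'I_k) :
  edge_decomposition (colour_classes c).
Proof.
split=> [|i j ij].
  apply/setP => e; rewrite inE; apply/bigcupP; exists (c e) => //.
  by rewrite inE.
rewrite -setI_eq0; apply/eqP/setP => e; rewrite !inE.
by apply/negP => /andP[/eqP-> /eqP e_ij]; rewrite e_ij eqxx in ij.
Qed.

Lemma outdeg_colour_class (c : edge G -> 'I_k) (i : 'I_k) (v : vertex G) :
  @outdeg (factor (colour_classes c i)) v
    = class_size c [pred e | src e == v] i.
Proof.
by rewrite factor_outdeg; apply: eq_card => e; rewrite !inE andbC.
Qed.

Lemma indeg_colour_class (c : edge G -> 'I_k) (i : 'I_k) (v : vertex G) :
  @indeg (factor (colour_classes c i)) v
    = class_size c [pred e | tgt e == v] i.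
Proof.
by rewrite factor_indeg; apply: eq_card => e; rewrite !inE andbC.
Qed.

Lemma share_close_multiple (a q : nat) : share_close k a (q * k) -> a = q.
Proof.
case/share_closeP => //; rewrite -mulSnr -mulnSr mulnC [k * _]mulnC.
by rewrite !ltn_pmul2r // => h1 h2; lia.
Qed.

Lemma exists_size_balanced :
  exists D : 'I_k -> {set edge G}, balanced_decomposition D /\ size_balanced D.
Proof.
(* The out-classes refine the one-class partition, whose equitability is condition (i). *)
have [//|c [cs ct cT]] := @equitable_colouring3 (edge G) _ unit _ k
  (@src G) (fun=> tt) (@tgt G) k0.
exists (colour_classes c); split; first split.
- exact: colour_classes_decomposition.
- move=> i v; rewrite outdeg_colour_class indeg_colour_class.
  by split; apply: equitable_share_close.
- move=> i; rewrite /size_balanced card_factor_edge.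
  have := equitable_share_close i (ct tt).
  have -> : class_size c [pred x : edge G | tt == tt] i = #|colour_classes c i|.
    by apply: eq_card => e; rewrite !inE.
  have -> // : #|[set x : edge G | [pred x : edge G | tt == tt] x]| = #|edge G|.
  by rewrite -cardsT; apply: eq_card => e; rewrite !inE.
Qed.

(** The divisible semidegree is shared exactly, so only the other one contributes an error. *)
Lemma share_close_deg (D : 'I_k -> {set edge G}) (i : 'I_k) (v : vertex G) :
  balanced_decomposition D -> k %| outdeg v \/ k %| indeg v ->
  share_close k (@deg (factor (D i)) v) (deg v).
Proof.
case=> _ /(_ i v) []; rewrite /deg => outP inP dvd.
apply/share_closeP => //; rewrite mulnDr.
case: dvd => /dvdnP[q Eq].
  move: outP; rewrite Eq => /share_close_multiple ->.
  by case/share_closeP: inP => // h1 h2; rewrite [k * q]mulnC; lia.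
move: inP; rewrite Eq => /share_close_multiple ->.
by case/share_closeP: outP => // h1 h2; rewrite [k * q]mulnC; lia.
Qed.

(** * Added loops and condition (ii) *)

(** The number of loops to add at [u]. The outer [%% k] turns [k] into 0 when the semidegrees are
    already divisible. *)
Definition pad (u : vertex G) : nat :=
  if outdeg u == indeg u %[mod k] then (k - outdeg u %% k) %% k else 0.

Lemma pad_lt (u : vertex G) : pad u < k.
Proof. by rewrite /pad; case: ifP; rewrite ?ltn_pmod. Qed.

Lemma dvdn_pad (u : vertex G) : outdeg u = indeg u %[mod k] ->
  (k %| outdeg u + pad u) && (k %| indeg u + pad u).
Proof.
move=> oi; rewrite /pad oi eqxx /dvdn !modnDmr -(modnDml (outdeg u)) oi.
rewrite -(modnDml (indeg u)) subnKC; last by rewrite ltnW // ltn_pmod.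
by rewrite modnn.
Qed.

Lemma exists_parity :
  exists D : 'I_k -> {set edge G},
    balanced_decomposition D /\ parity_condition D.
Proof.
pose L := {u : vertex G & 'I_(pad u)}.
pose src' (x : edge G + L) := match x with inl e => src e | inr l => tag l end.
pose tgt' (x : edge G + L) := match x with inl e => tgt e | inr l => tag l end.
pose is_loop (x : edge G + L) := if x is inr _ then true else false.
(* Tagging with [is_loop] splits each padded out-class into original edges and added loops. *)
have [x y [] //|c [cl cs ct]] := @equitable_colouring3 _ _ _ _ k
  (fun x => (src' x, is_loop x)) src' tgt' k0.
pose m u i := class_size c [pred x | (src' x, is_loop x) == (u, true)] i.
have split_card (P : pred (edge G + L)) :
    #|[set x | P x]| = #|[set e | P (inl e)]| + #|[set l | P (inr l)]|.
  rewrite -!sum1_card big_sumType /=.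
  by congr (_ + _); apply: eq_bigl => x; rewrite !inE.
have padE u : #|[set l : L | tag l == u]| = pad u.
  rewrite -sum1_card.
  transitivity (\sum_(v | v == u) \sum_(j < pad v) 1).
    by rewrite sig_big_dep /=; apply: eq_bigl => l; rewrite inE andbT.
  by rewrite big_pred1_eq sum1_card card_ord.
have mP u i : share_close k (m u i) (pad u).
  have := equitable_share_close i (cl (u, true)); rewrite split_card /=.
  rewrite -/(m u i) (_ : [set e | _] = set0) ?cards0; last first.
    by apply/setP => e; rewrite !inE xpair_eqE andbF.
  rewrite (_ : #|[set l | _]| = pad u) // -padE; apply: eq_card => l.
  by rewrite !inE xpair_eqE andbT.
pose c0 e := c (inl e).
have mE u i : m u i = #|[set l : L | (tag l == u) && (c (inr l) == i)]|.
  rewrite /m /class_size split_card (_ : [set e | _] = set0) ?cards0;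
    last by apply/setP => e; rewrite !inE /= xpair_eqE andbF.
  by apply: eq_card => l; rewrite !inE /= xpair_eqE andbT.
have outE u i : share_close k (class_size c0 [pred e | src e == u] i + m u i)
    (outdeg u + pad u).
  have := equitable_share_close i (cs u).
  by rewrite /class_size !split_card mE -padE.
have inE' u i : share_close k (class_size c0 [pred e | tgt e == u] i + m u i)
    (indeg u + pad u).
  have := equitable_share_close i (ct u).
  by rewrite /class_size !split_card mE -padE.
(* k m < pad + k < 2k. *)
have m_le1 u i : m u i <= 1.
  have [+ _] := (share_closeP (m u i) (pad u) k0).1 (mP u i).
  by have := pad_lt u; nia.
(* The padded share is exact, so k(a + m) = d + pad. If m = 0, [pad u < k] suffices; if m = 1, [h]
   forces [pad u] to be positive, which gives d < k a + k. *)
have unpad u i a d : k %| d + pad u ->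
    share_close k (a + m u i) (d + pad u) -> share_close k a d.
  move=> /dvdnP[q Eq]; rewrite Eq => /share_close_multiple aq.
  have [h _] := (share_closeP (m u i) (pad u) k0).1 (mP u i).
  apply/share_closeP => //; have := pad_lt u; have := m_le1 u i.
  by case: (m u i) aq h => [|[|//]] aq h _ ?; nia.
have balanced : balanced_decomposition (colour_classes c0).
  split=> [|i u]; first exact: colour_classes_decomposition.
  rewrite outdeg_colour_class indeg_colour_class.
  have [oi|noi] := eqVneq (outdeg u %% k) (indeg u %% k).
    have /andP[dvo dvi] := dvdn_pad oi.
    by split; [apply: unpad dvo (outE u i)|apply: unpad dvi (inE' u i)].
  have pad0 : pad u = 0 by rewrite /pad (negPf noi).
  have m0 : m u i = 0.
    have [h _] := (share_closeP (m u i) (pad u) k0).1 (mP u i).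
    by rewrite pad0 in h; nia.
  by move: (outE u i) (inE' u i); rewrite pad0 m0 !addn0.
exists (colour_classes c0); split=> // u oi i.
have /andP[/dvdnP[q Eq] /dvdnP[r Er]] := dvdn_pad oi.
move: (outE u i) (inE' u i); rewrite Eq Er => /share_close_multiple outq.
move=> /share_close_multiple inr.
rewrite /deg outdeg_colour_class indeg_colour_class.
(* The padding cancels, so the quotient is q - r; the degree in the factor is q + r - 2m, of the
   same parity. *)
have -> : ((outdeg u)%:Z - (indeg u)%:Z)%R = ((q%:Z - r%:Z) * k%:Z)%R.
  by rewrite mulrBl -!PoszM -Eq -Er !PoszD; lia.
rewrite mulzK; last by case: (k) k0.
lia.
Qed.

End Factors.

Theorem theorem2p1 (k : nat) (hk : (0 < k)%N) (G : digraph) :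
  (exists D : 'I_k -> {set edge G}, balanced_decomposition D) /\
  (forall D : 'I_k -> {set edge G}, balanced_decomposition D ->
     forall (i : 'I_k) (v : vertex G),
       (k %| outdeg v)%N \/ (k %| indeg v)%N ->
       share_close k (@deg (factor (D i)) v) (deg v)) /\
  (exists D : 'I_k -> {set edge G},
     balanced_decomposition D /\ size_balanced D) /\
  (exists D : 'I_k -> {set edge G},
     balanced_decomposition D /\ parity_condition D).
Proof.
split; last split; last split.
- by have [D [DP _]] := exists_size_balanced G hk; exists D.
- by move=> D DP i v; apply: share_close_deg.
- exact: exists_size_balanced.
- exact: exists_parity.
Qed.
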